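(* Let $a_L<a_R$, let $U_R=(h_R,u_R,a_R)\in A_3$ and let $U_L=(h_L,u_L,a_L)$. Set $U_1=(h_1,u_1,a_L):=SW(U_R,a_L)$ and $U_2=(h_2,u_2,a_L):=\mathcal W_2^B(U_1)\cap\mathcal W_1(U_L)$. Then a solution of the Riemann problem for the shallow water equations with data $(U_L,U_R)$ exists and has the structure $$W_1(U_L,U_2)\oplus W_2(U_2,U_1)\oplus W_3(U_1,U_R),$$ provided $h_2\le\bar h_1$, where $\bar h_1$ is the $h$-component of the state $\bar U_1$ associated with $U_1$.
   Context: System: $\partial_t h+\partial_x(hu)=0$, $\partial_t(hu)+\partial_x\big(h(u^2+g h/2)\big)=-gh\,\partial_x a$, $\partial_t a=0$, with $g>0$ the gravity constant and state $U=(h,u,a)$ ($h$ water height, $u$ velocity, $a$ bottom level). The Riemann problem with data $(U_L,U_R)$ has initial condition $U_L$ for $x<0$ and $U_R$ for $x>0$. Characteristic speeds: $\lambda_1(U)=u-\sqrt{gh}$, $\lambda_2(U)=u+\sqrt{gh}$, $\lambda_3(U)=0$. Regions: $A_1=\{\lambda_2>\lambda_1>\lambda_3\}$, $A_2=\{\lambda_2>\lambda_3>\lambda_1\}$, $A_2^-=A_2\cap\{u<0\}$, $A_3=\{\lambda_3>\lambda_2>\lambda_1\}$; $\mathcal C=\{u^2=gh\}$. Wave curves through $U_0=(h_0,u_0,a_0)$ (the component $a$ stays constant across these waves). $\mathcal W_1(U_0)$, consisting of right-hand states that can be connected to the left-hand state $U_0$ by a 1-wave: $u=u_0-\sqrt{g/2}\,(h-h_0)\sqrt{1/h+1/h_0}$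 for $h>h_0$ (Lax 1-shock), $u=u_0-2\sqrt g(\sqrt h-\sqrt{h_0})$ for $h\le h_0$ (1-rarefaction). $\mathcal W_2^B(U_0)$, consisting of left-hand states that can be connected to the right-hand state $U_0$ by a 2-wave: $u=u_0+\sqrt{g/2}\,(h-h_0)\sqrt{1/h+1/h_0}$ for $h>h_0$ (Lax 2-shock; this part is denoted $\mathcal S_2^B(U_0)$), $u=u_0+2\sqrt g(\sqrt h-\sqrt{h_0})$ for $h\le h_0$ (2-rarefaction). The shock speed between $U_0$ and $U$ is $(hu-h_0u_0)/(h-h_0)$. For $U_0\in A_3$, $\bar U_0$ denotes the state in $\mathcal S_2^B(U_0)\cap A_2^-$, with height $\bar h_0>h_0$, for which the 2-shock speed between $U_0$ and $\bar U_0$ is $0$. Stationary waves: a stationary wave is a discontinuity of zero speed joining states $U_0$ and $U$ with $hu=h_0u_0$ and $\frac{u^2}{2}+g(h+a)=\frac{u_0^2}{2}+g(h_0+a_0)$. The stationary curve $\mathcal W_3(U_0)$ is the curve, parameterized by $h$, of the states that can be connected to $U_0$ in this way. Monotonicity Criterion (MC): along any stationary curve, the bottom level $a$ is a monotone function of $h$, and the total variation of the bottom level in a Riemann solution must not exceed (hence equals) $|a_L-a_R|$. $SW(U_0,a)$ denotes the state with bottom level $a$ that can be connected to $U_0$ by a stationary wave satisfying (MC); it is single-valued for $U_0\notin\mathcal C$ and two-valued on $\mathcal C$. $W_i(U,V)$ denotes the $i$-wave with left-hand state $U$ and right-hand state $V$ (Lax shock or rarefaction for $i=1,2$, stationary wave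 for $i=3$), and $W_i(U,V)\oplus W_j(V,Z)$ means that the wave $W_i(U,V)$ is followed by the wave $W_j(V,Z)$. Solutions are built from Lax shocks, rarefaction waves and stationary waves satisfying (MC). *)

(* Defs.v *)
From Stdlib Require Import Reals List.
From Coquelicot Require Import Coquelicot.
Import ListNotations.
Open Scope R_scope.

Record state := mkState { height : R; velocity : R; bottom : R }.

Definition discharge (U : state) : R := height U * velocity U.

Definition momentum_flux (g : R) (U : state) : R :=
  height U * (velocity U ^ 2 + g * height U / 2).

Definition system_at (g : R) (U : R -> R -> state) (x t : R) : Prop :=
  (forall f, In f [height; velocity; bottom] ->
     ex_derive (fun y => f (U y t)) x /\ ex_derive (fun s => f (U x s)) t) /\
  Derive (fun s => height (U x s)) t + Derive (fun y => discharge (U y t)) x = 0 /\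
  Derive (fun s => discharge (U x s)) t
    + Derive (fun y => momentum_flux g (U y t)) x
    = - g * height (U x t) * Derive (fun y => bottom (U y t)) x /\
  Derive (fun s => bottom (U x s)) t = 0.

Inductive family := F1 | F2 | F3.

Definition lambda (g : R) (k : family) (U : state) : R :=
  match k with
  | F1 => velocity U - sqrt (g * height U)
  | F2 => velocity U + sqrt (g * height U)
  | F3 => 0
  end.

Definition A2 (g : R) (U : state) : Prop :=
  lambda g F2 U > lambda g F3 U /\ lambda g F3 U > lambda g F1 U.

Definition A2minus (g : R) (U : state) : Prop := A2 g U /\ velocity U < 0.

Definition A3 (g : R) (U : state) : Prop :=
  lambda g F3 U > lambda g F2 U /\ lambda g F2 U > lambda g F1 U.

Definition shock_speed (U0 U : state) : R :=
  (discharge U - discharge U0) / (height U - height U0).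

(* On all the curves below the height is positive: vacuum states are excluded. *)

Definition W1 (g : R) (U0 U : state) : Prop :=
  0 < height U /\ bottom U = bottom U0 /\
  ((height U > height U0 /\
    velocity U = velocity U0
      - sqrt (g / 2) * (height U - height U0)
        * sqrt (1 / height U + 1 / height U0))
   \/
   (height U <= height U0 /\
    velocity U = velocity U0
      - 2 * sqrt g * (sqrt (height U) - sqrt (height U0)))).

Definition S2B (g : R) (U0 U : state) : Prop :=
  0 < height U /\ bottom U = bottom U0 /\
  height U > height U0 /\
  velocity U = velocity U0
    + sqrt (g / 2) * (height U - height U0)
      * sqrt (1 / height U + 1 / height U0).

Definition W2B (g : R) (U0 U : state) : Prop :=
  S2B g U0 U \/
  (0 < height U /\ bottom U = bottom U0 /\
   height U <= height U0 /\
   velocity U = velocity U0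
     + 2 * sqrt g * (sqrt (height U) - sqrt (height U0))).

(* [is_bar g U0 U] : [U] is the state \bar U_0 associated with [U0] in A_3. *)
Definition is_bar (g : R) (U0 U : state) : Prop :=
  A3 g U0 /\ S2B g U0 U /\ A2minus g U /\ shock_speed U0 U = 0.

(* Stationary curve W_3(U0). *)
Definition W3 (g : R) (U0 U : state) : Prop :=
  0 < height U0 /\ 0 < height U /\
  discharge U = discharge U0 /\
  velocity U ^ 2 / 2 + g * (height U + bottom U)
    = velocity U0 ^ 2 / 2 + g * (height U0 + bottom U0).

(* Bottom level along W_3(U0), as a function of the height: the two equations
   of [W3] solved for [bottom]. *)
Definition W3_bottom (g : R) (U0 : state) (h : R) : R :=
  bottom U0 + (velocity U0 ^ 2 - (discharge U0 / h) ^ 2) / (2 * g) + height U0 - h.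

(* Monotonicity of the bottom level along the arc of W_3(U0) from [U0] to [U]. *)
Definition MC (g : R) (U0 U : state) : Prop :=
  let lo := Rmin (height U0) (height U) in
  let hi := Rmax (height U0) (height U) in
  (forall x y, lo <= x -> x <= y -> y <= hi ->
     W3_bottom g U0 x <= W3_bottom g U0 y)
  \/
  (forall x y, lo <= x -> x <= y -> y <= hi ->
     W3_bottom g U0 y <= W3_bottom g U0 x).

(* A relation, since SW(U0, a) may be two-valued for [U0] on the critical curve. *)
Definition SW (g : R) (U0 : state) (a : R) (U : state) : Prop :=
  W3 g U0 U /\ MC g U0 U /\ bottom U = a.

(* Elementary waves, with left-hand state [Um] and right-hand state [Up].
   A rarefaction carries its fan, a function of x/t. *)
Inductive wave :=
| Shock (k : family) (Um Up : state)
| Rarefaction (k : family) (Um Up : state) (fan : R -> state)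
| Stationary (Um Up : state).

Definition wave_family (w : wave) : family :=
  match w with Shock k _ _ | Rarefaction k _ _ _ => k | Stationary _ _ => F3 end.

Definition wave_left (w : wave) : state :=
  match w with Shock _ U _ | Rarefaction _ U _ _ | Stationary U _ => U end.

Definition wave_right (w : wave) : state :=
  match w with Shock _ _ U | Rarefaction _ _ U _ | Stationary _ U => U end.

(* A wave occupies the sector [slow <= x/t <= fast]. *)
Definition slow (g : R) (w : wave) : R :=
  match w with
  | Shock _ Um Up => shock_speed Um Up
  | Rarefaction k Um _ _ => lambda g k Um
  | Stationary _ _ => 0
  end.

Definition fast (g : R) (w : wave) : R :=
  match w with
  | Shock _ Um Up => shock_speed Um Up
  | Rarefaction k _ Up _ => lambda g k Up
  | Stationary _ _ => 0
  end.

(* Rankine-Hugoniot relations and Lax inequalities. *)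
Definition lax_shock (g : R) (k : family) (Um Up : state) : Prop :=
  let s := shock_speed Um Up in
  k <> F3 /\ 0 < height Um /\ 0 < height Up /\ bottom Up = bottom Um /\
  s * (height Up - height Um) = discharge Up - discharge Um /\
  s * (discharge Up - discharge Um) = momentum_flux g Up - momentum_flux g Um /\
  lambda g k Up < s < lambda g k Um.

(* Centered rarefaction; a trivial wave [Um = Up] is included. *)
Definition rarefaction (g : R) (k : family) (Um Up : state) (fan : R -> state) : Prop :=
  let sm := lambda g k Um in
  let sp := lambda g k Up in
  k <> F3 /\ sm <= sp /\ fan sm = Um /\ fan sp = Up /\
  (forall xi, sm <= xi <= sp ->
     0 < height (fan xi) /\ bottom (fan xi) = bottom Um /\
     lambda g k (fan xi) = xi) /\
  continuous_on (fun xi => sm <= xi <= sp) (fun xi => height (fan xi)) /\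
  continuous_on (fun xi => sm <= xi <= sp) (fun xi => velocity (fan xi)) /\
  (forall x t, 0 < t -> sm < x / t < sp ->
     system_at g (fun y s => fan (y / s)) x t).

Definition admissible (g : R) (w : wave) : Prop :=
  match w with
  | Shock k Um Up => lax_shock g k Um Up
  | Rarefaction k Um Up fan => rarefaction g k Um Up fan
  | Stationary Um Up => W3 g Um Up /\ MC g Um Up
  end.

(* [is_wave g k U V w] : [w] is a k-wave W_k(U,V). *)
Definition is_wave (g : R) (k : family) (U V : state) (w : wave) : Prop :=
  wave_family w = k /\ wave_left w = U /\ wave_right w = V /\ admissible g w.

(* [chain g U V ws] : the waves [ws] follow each other from [U] to [V].  Equal
   speeds are allowed: a shock of zero speed may sit on a stationary wave. *)
Fixpoint chain (g : R) (U V : state) (ws : list wave) : Prop :=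
  match ws with
  | [] => U = V
  | w :: ws' =>
      wave_left w = U /\ admissible g w /\
      match ws' with [] => True | w' :: _ => fast g w <= slow g w' end /\
      chain g (wave_right w) V ws'
  end.

(* The self-similar function of [xi = x/t] made of the waves [ws], from [U]. *)
Fixpoint profile (g : R) (U : state) (ws : list wave) (xi : R) : state :=
  match ws with
  | [] => U
  | w :: ws' =>
      if Rlt_dec xi (slow g w) then U
      else if Rlt_dec xi (fast g w) then
        match w with Rarefaction _ _ _ fan => fan xi | _ => wave_right w end
      else profile g (wave_right w) ws' xi
  end.

(* Each wave being monotone in the bottom level, this is the total variation. *)
Definition bottom_variation (ws : list wave) : R :=
  fold_right Rplus 0
    (map (fun w => Rabs (bottom (wave_right w) - bottom (wave_left w))) ws).

Definition initial_value (U : R -> R -> state) (x : R) (U0 : state) : Prop :=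
  forall f, In f [height; velocity; bottom] ->
    filterlim (fun t => f (U x t)) (at_right 0) (locally (f U0)).

(* [U x t] solves the Riemann problem with data [UL], [UR] and is composed of
   the waves [ws].  Jumps are treated by [chain]; off the edges of the waves the
   system holds in the classical sense. *)
Definition riemann_solution (g : R) (UL UR : state) (ws : list wave)
    (U : R -> R -> state) : Prop :=
  chain g UL UR ws /\
  bottom_variation ws <= Rabs (bottom UL - bottom UR) /\
  (forall x t, 0 < t -> U x t = profile g UL ws (x / t)) /\
  (forall x t, 0 < t ->
     (forall w, In w ws -> x / t <> slow g w /\ x / t <> fast g w) ->
     system_at g U x t) /\
  (forall x, x < 0 -> initial_value U x UL) /\
  (forall x, 0 < x -> initial_value U x UR).

(* Main.v *)
Require Import Defs.
From Stdlib Require Import Reals List Lra.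
From Coquelicot Require Import Coquelicot.
Import ListNotations.
Open Scope R_scope.

(** On the supercritical part of a stationary curve the bottom level increases
    strictly with the height from [-oo], and past the critical height it
    decreases; so the stationary state [U1] at the lower level [bottom UL]
    exists, is the only one reached monotonically, and stays in [A3].  In the
    wave pattern the speeds are ordered because [velocity U2] separates the
    1-wave from the 2-wave (Lax shocks and rarefactions alike), while the 2-wave
    does not overtake the stationary one: a 2-rarefaction ends at
    [lambda_2 U1 < 0], and the speed of a 2-shock arriving at [U1] increases with
    its left height and vanishes exactly at [U1bar]. *)

(** * Self-similar profiles as solutions *)

Lemma state_eq (U V : state) :
  height U = height V -> velocity U = velocity V -> bottom U = bottom V -> U = V.
Proof. destruct U, V; simpl; intros; subst; reflexivity. Qed.

Lemma locally_lt_l (a x : R) : a < x -> locally x (fun y => a < y).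
Proof. apply (open_gt a). Qed.

Lemma locally_lt_r (b x : R) : x < b -> locally x (fun y => y < b).
Proof. apply (open_lt b). Qed.

Lemma continuous_ratio_l (x t : R) : 0 < t -> continuous (fun y => y / t) x.
Proof.
  intros Ht. apply (ex_derive_continuous (K := R_AbsRing) (V := R_NormedModule)). auto_derive. lra.
Qed.

Lemma continuous_ratio_r (x t : R) : 0 < t -> continuous (fun s => x / s) t.
Proof.
  intros Ht. apply (ex_derive_continuous (K := R_AbsRing) (V := R_NormedModule)). auto_derive. lra.
Qed.

(** Derivatives are local, and [x / t] is continuous in each variable separately, so agreement near
    [x / t] passes to both partial derivatives. *)
Lemma system_at_ext_loc (g : R) (P Q : R -> state) (x t : R) :
  0 < t -> locally (x / t) (fun xi => P xi = Q xi) ->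
  system_at g (fun y s => P (y / s)) x t -> system_at g (fun y s => Q (y / s)) x t.
Proof.
  intros Ht HPQ (Hex & Hmass & Hmom & Hbot).
  assert (Hx : locally x (fun y => P (y / t) = Q (y / t)))
    by exact (continuous_ratio_l x t Ht _ HPQ).
  assert (Hs : locally t (fun s => P (x / s) = Q (x / s)))
    by exact (continuous_ratio_r x t Ht _ HPQ).
  assert (Ex : forall f : state -> R,
    @locally R_UniformSpace x (fun y : R => f (P (y / t)) = f (Q (y / t)))).
  { intros f. apply (filter_imp _ _ (fun y H => f_equal f H) Hx). }
  assert (Es : forall f : state -> R,
    @locally R_UniformSpace t (fun s : R => f (P (x / s)) = f (Q (x / s)))).
  { intros f. apply (filter_imp _ _ (fun y H => f_equal f H) Hs). }
  assert (E0 : P (x / t) = Q (x / t)) by exact (locally_singleton _ _ Hx).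
  unfold system_at in *; cbv beta in *.
  rewrite (Derive_ext_loc _ _ _ (Es height)), (Derive_ext_loc _ _ _ (Es discharge)),
    (Derive_ext_loc _ _ _ (Ex discharge)), (Derive_ext_loc _ _ _ (Ex (momentum_flux g))), E0 in *.
  rewrite (Derive_ext_loc _ _ _ (Es bottom)) in Hbot.
  rewrite (Derive_ext_loc _ _ _ (Ex bottom)) in Hmom.
  split; [| auto].
  intros f Hf. destruct (Hex f Hf) as [H1 H2]. split.
  - exact (ex_derive_ext_loc _ _ _ (Ex f) H1).
  - exact (ex_derive_ext_loc _ _ _ (Es f) H2).
Qed.

Lemma system_at_const (g : R) (U : state) (x t : R) :
  system_at g (fun _ _ => U) x t.
Proof.
  unfold system_at. rewrite !Derive_const. repeat split; try ring.
  - apply ex_derive_const.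
  - apply ex_derive_const.
Qed.

(** Off the edges [x / t] lies in an open sector, where the profile coincides locally with a
    constant, with a fan, or with the profile of the remaining waves. *)
Lemma profile_system (g : R) (V : state) (ws : list wave) :
  forall U x t, chain g U V ws -> 0 < t ->
  (forall w, In w ws -> x / t <> slow g w /\ x / t <> fast g w) ->
  system_at g (fun y s => profile g U ws (y / s)) x t.
Proof.
  induction ws as [|w ws IH]; intros U x t Hc Ht Hoff.
  - exact (system_at_const g U x t).
  - set (Q := profile g U (w :: ws)).
    change (system_at g (fun y s => Q (y / s)) x t).
    destruct Hc as (_ & Hadm & _ & Hc).
    destruct (Hoff w (or_introl eq_refl)) as [Hs Hf].
    destruct (Rlt_dec (x / t) (slow g w)) as [Hlt|Hge].
    + apply (system_at_ext_loc g (fun _ => U) Q); [exact Ht | | exact (system_at_const g U x t)].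
      apply (filter_imp _ _) with (2 := locally_lt_r _ _ Hlt).
      intros y Hy. unfold Q; simpl. destruct (Rlt_dec y (slow g w)); [reflexivity | lra].
    + assert (Hgt : slow g w < x / t) by lra.
      destruct (Rlt_dec (x / t) (fast g w)) as [Hlt|Hge'].
      (* Shocks and stationary waves have [slow = fast], so only a rarefaction has an interior. *)
      * destruct w as [k Um Up|k Um Up fan|Um Up]; simpl in Hlt, Hgt, Hadm; try lra.
        apply (system_at_ext_loc g fan Q); [exact Ht | |].
        -- generalize (filter_and _ _ (locally_lt_r _ _ Hlt) (locally_lt_l _ _ Hgt)).
           apply filter_imp. intros y [Hy1 Hy2]. unfold Q; simpl.
           destruct (Rlt_dec y (lambda g k Um)); [lra|].
           destruct (Rlt_dec y (lambda g k Up)); [reflexivity | lra].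
        -- apply Hadm; auto.
      * assert (Hgt' : fast g w < x / t) by lra.
        apply (system_at_ext_loc g (profile g (wave_right w) ws) Q); [exact Ht | |].
        -- generalize (filter_and _ _ (locally_lt_l _ _ Hgt) (locally_lt_l _ _ Hgt')).
           apply filter_imp. intros y [Hy1 Hy2]. unfold Q; simpl.
           destruct (Rlt_dec y (slow g w)); [lra|].
           destruct (Rlt_dec y (fast g w)); [lra | reflexivity].
        -- apply IH; auto. intros w' Hw'. apply Hoff. right; exact Hw'.
Qed.

Lemma profile_left (g : R) (U : state) (ws : list wave) :
  exists M, forall xi, xi < M -> profile g U ws xi = U.
Proof.
  destruct ws as [|w ws]; simpl.
  - exists 0. reflexivity.
  - exists (slow g w). intros xi Hxi.
    destruct (Rlt_dec xi (slow g w)); [reflexivity | lra].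
Qed.

Lemma profile_right (g : R) (V : state) (ws : list wave) :
  forall U, chain g U V ws -> exists M, forall xi, M < xi -> profile g U ws xi = V.
Proof.
  induction ws as [|w ws IH]; simpl; intros U Hc.
  - exists 0. auto.
  - destruct Hc as (_ & _ & _ & Hc). destruct (IH _ Hc) as [M HM].
    exists (Rmax M (Rmax (slow g w) (fast g w))). intros xi Hxi.
    pose proof (Rmax_l M (Rmax (slow g w) (fast g w))).
    pose proof (Rmax_r M (Rmax (slow g w) (fast g w))).
    pose proof (Rmax_l (slow g w) (fast g w)).
    pose proof (Rmax_r (slow g w) (fast g w)).
    destruct (Rlt_dec xi (slow g w)); [lra|].
    destruct (Rlt_dec xi (fast g w)); [lra|]. apply HM. lra.
Qed.

Lemma initial_value_eventually_eq (P : R -> state) (x : R) (U0 : state) :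
  at_right 0 (fun t => P (x / t) = U0) ->
  initial_value (fun y s => P (y / s)) x U0.
Proof.
  intros H f _. apply (filterlim_ext_loc (fun _ => f U0)).
  - apply (filter_imp _ _) with (2 := H). intros t E. now rewrite E.
  - apply filterlim_const.
Qed.

Lemma ratio_to_infinity (x M : R) : 0 < x -> at_right 0 (fun t => M < x / t).
Proof.
  intros Hx.
  assert (HM : 0 < Rabs M + 1) by (pose proof (Rabs_pos M); lra).
  (* The radius is [x / (Rabs M + 1)]; the [+ 1] keeps the denominator positive. *)
  exists (mkposreal _ (Rdiv_lt_0_compat _ _ Hx HM)). simpl. intros t Ht Ht0.
  unfold ball in Ht; simpl in Ht; unfold AbsRing_ball, abs, minus, plus, opp in Ht; simpl in Ht.
  rewrite Ropp_0, Rplus_0_r, Rabs_pos_eq in Ht by lra.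
  apply Rle_lt_trans with (Rabs M); [apply Rle_abs|].
  apply (Rmult_lt_reg_r t); [exact Ht0|].
  replace (x / t * t) with x by (field; lra).
  apply (Rmult_lt_compat_r (Rabs M + 1)) in Ht; [|exact HM].
  replace (x / (Rabs M + 1) * (Rabs M + 1)) with x in Ht by (field; lra). nra.
Qed.

(** Reduces the theorem to algebra on the list of waves. The initial data are attained because
    [x / t] leaves every bounded set of speeds as [t] tends to 0. *)
Lemma riemann_solution_of_chain (g : R) (UL UR : state) (ws : list wave) :
  chain g UL UR ws -> bottom_variation ws <= Rabs (bottom UL - bottom UR) ->
  riemann_solution g UL UR ws (fun x t => profile g UL ws (x / t)).
Proof.
  intros Hc Hb.
  refine (conj Hc (conj Hb (conj _ (conj _ (conj _ _))))).
  - reflexivity.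
  - intros x t Ht Hoff. exact (profile_system g UR ws UL x t Hc Ht Hoff).
  - intros x Hx. destruct (profile_left g UL ws) as [M HM].
    apply (initial_value_eventually_eq (profile g UL ws)).
    (* Reflection: [x / t < M] is [- M < - x / t]. *)
    assert (Hx' : 0 < - x) by lra.
    apply (filter_imp _ _) with (2 := ratio_to_infinity (- x) (- M) Hx').
    intros t Ht. apply HM. unfold Rdiv in *. lra.
  - intros x Hx. destruct (profile_right g UR ws UL Hc) as [M HM].
    apply (initial_value_eventually_eq (profile g UL ws)).
    apply (filter_imp _ _) with (2 := ratio_to_infinity x M Hx).
    intros t Ht. apply HM, Ht.
Qed.

(** * Centered rarefactions *)

(* With [c = sqrt (g h)], the Riemann invariant [C] ([u - 2 c] for the second
   family, [u + 2 c] for the first) is constant across the fan, and [xi = u + c],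
   resp. [u - c], gives [u = (C + 2 xi) / 3] and [c = |xi - C| / 3]. *)
Definition fan (g C a xi : R) : state :=
  mkState (((xi - C) / 3) ^ 2 / g) ((C + 2 * xi) / 3) a.

Lemma fan_system (g C a x t : R) :
  0 < g -> 0 < t -> system_at g (fun y s => fan g C a (y / s)) x t.
Proof.
  intros Hg Ht. unfold system_at, discharge, momentum_flux, fan; simpl.
  split; [|repeat split].
  - intros f [<-|[<-|[<-|[]]]]; simpl; split; auto_derive; repeat split; lra.
  - erewrite !is_derive_unique by (auto_derive; [repeat split; lra | reflexivity]).
    field; lra.
  - erewrite !is_derive_unique by (auto_derive; [repeat split; lra | reflexivity]).
    field; lra.
  - apply Derive_const.
Qed.

Lemma fan_celerity (g C a xi : R) :
  0 < g -> sqrt (g * height (fan g C a xi)) = Rabs ((xi - C) / 3).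
Proof.
  intros Hg. simpl height. rewrite <- sqrt_Rsqr_abs. f_equal. unfold Rsqr. field; lra.
Qed.

(** The sign of [c] is left free: [c] is the celerity for the second family and its opposite for the
    first. *)
Lemma fan_eq (g C xi : R) (U : state) (c : R) :
  0 < g -> c ^ 2 = g * height U ->
  velocity U + c = xi -> velocity U - 2 * c = C -> U = fan g C (bottom U) xi.
Proof.
  intros Hg Hc <- <-. apply state_eq; simpl; try field.
  replace ((velocity U + c - (velocity U - 2 * c)) / 3) with c by field.
  change (c * (c * 1)) with (c ^ 2). rewrite Hc. field; lra.
Qed.

(** Common to both families. The height of the fan vanishes only at [xi = C], so [xi <> C] excludes
    vacuum. *)
Lemma rarefaction_fan (g C a : R) (k : Defs.family) (Um Up : state) :
  0 < g -> k <> F3 -> lambda g k Um <= lambda g k Up ->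
  fan g C a (lambda g k Um) = Um -> fan g C a (lambda g k Up) = Up ->
  (forall xi, lambda g k Um <= xi <= lambda g k Up ->
     xi <> C /\ lambda g k (fan g C a xi) = xi) ->
  rarefaction g k Um Up (fan g C a).
Proof.
  intros Hg Hk Hle Em Ep Hfan. unfold rarefaction. cbv zeta.
  assert (Ea : bottom Um = a) by (rewrite <- Em; reflexivity).
  refine (conj Hk (conj Hle (conj Em (conj Ep (conj _ (conj _ (conj _ _))))))).
  - intros xi Hxi. destruct (Hfan _ Hxi) as [Hne Hl].
    split; [|split; [symmetry; exact Ea | exact Hl]].
    simpl. apply Rdiv_lt_0_compat; [|exact Hg].
    assert (0 < ((xi - C) / 3) ^ 2) by (apply pow2_gt_0; lra). simpl in *; lra.
  - apply continuous_on_forall. intros xi _.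
    apply (ex_derive_continuous (K := R_AbsRing) (V := R_NormedModule)).
    simpl. auto_derive. lra.
  - apply continuous_on_forall. intros xi _.
    apply (ex_derive_continuous (K := R_AbsRing) (V := R_NormedModule)).
    simpl. auto_derive. lra.
  - intros x t Ht _. now apply fan_system.
Qed.

Lemma rarefaction_1 (g : R) (Um Up : state) :
  0 < g -> 0 < height Up -> bottom Up = bottom Um -> height Up <= height Um ->
  velocity Up = velocity Um - 2 * sqrt g * (sqrt (height Up) - sqrt (height Um)) ->
  exists f, rarefaction g F1 Um Up f.
Proof.
  intros Hg Hp Hb Hle Hv.
  assert (Hcp : 0 < sqrt (g * height Up)) by (apply sqrt_lt_R0; nra).
  assert (Hcle : sqrt (g * height Up) <= sqrt (g * height Um)) by (apply sqrt_le_1; nra).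
  assert (Sp : sqrt (g * height Up) ^ 2 = g * height Up) by (apply pow2_sqrt; nra).
  assert (Sm : sqrt (g * height Um) ^ 2 = g * height Um) by (apply pow2_sqrt; nra).
  assert (Hinv : velocity Up + 2 * sqrt (g * height Up)
                 = velocity Um + 2 * sqrt (g * height Um)).
  { rewrite !sqrt_mult by lra. rewrite Hv. ring. }
  remember (velocity Um + 2 * sqrt (g * height Um)) as C eqn:HC.
  exists (fan g C (bottom Um)). apply rarefaction_fan; cbn [lambda]; [exact Hg | discriminate | lra | | |].
  - symmetry. apply fan_eq with (c := - sqrt (g * height Um)); lra.
  - symmetry. rewrite <- Hb. apply fan_eq with (c := - sqrt (g * height Up)); lra.
  - intros xi Hxi. split; [lra|].
    (* In the first family [xi - C] is negative: at the fast edge it equals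
       [- 3 * sqrt (g * height Up)]. *)
    rewrite fan_celerity by exact Hg. simpl. rewrite Rabs_left; lra.
Qed.

Lemma rarefaction_2 (g : R) (Um Up : state) :
  0 < g -> 0 < height Um -> bottom Um = bottom Up -> height Um <= height Up ->
  velocity Um = velocity Up + 2 * sqrt g * (sqrt (height Um) - sqrt (height Up)) ->
  exists f, rarefaction g F2 Um Up f.
Proof.
  intros Hg Hm Hb Hle Hv.
  assert (Hcm : 0 < sqrt (g * height Um)) by (apply sqrt_lt_R0; nra).
  assert (Hcle : sqrt (g * height Um) <= sqrt (g * height Up)) by (apply sqrt_le_1; nra).
  assert (Sp : sqrt (g * height Up) ^ 2 = g * height Up) by (apply pow2_sqrt; nra).
  assert (Sm : sqrt (g * height Um) ^ 2 = g * height Um) by (apply pow2_sqrt; nra).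
  assert (Hinv : velocity Um - 2 * sqrt (g * height Um)
                 = velocity Up - 2 * sqrt (g * height Up)).
  { rewrite !sqrt_mult by lra. rewrite Hv. ring. }
  remember (velocity Up - 2 * sqrt (g * height Up)) as C eqn:HC.
  exists (fan g C (bottom Up)). apply rarefaction_fan; cbn [lambda]; [exact Hg | discriminate | lra | | |].
  - symmetry. rewrite <- Hb. apply fan_eq with (c := sqrt (g * height Um)); lra.
  - symmetry. apply fan_eq with (c := sqrt (g * height Up)); lra.
  - intros xi Hxi. split; [lra|].
    rewrite fan_celerity by exact Hg. simpl. rewrite Rabs_pos_eq; lra.
Qed.

(** * Shock curves, Rankine-Hugoniot relations and Lax inequalities *)

(* [|velocity U - velocity U0| = slope * |height U - height U0|] on the shock curves. *)
Lemma shock_slope (g h h0 : R) :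
  0 < g -> 0 < h -> 0 < h0 ->
  let sl := sqrt (g / 2) * sqrt (1 / h + 1 / h0) in
  0 < sl /\ 2 * h * h0 * sl ^ 2 = g * (h + h0).
Proof.
  intros Hg Hh Hh0 sl.
  assert (0 < 1 / h) by (apply Rdiv_lt_0_compat; lra).
  assert (0 < 1 / h0) by (apply Rdiv_lt_0_compat; lra).
  split.
  - apply Rmult_lt_0_compat; apply sqrt_lt_R0; lra.
  - unfold sl. rewrite Rpow_mult_distr, !pow2_sqrt by lra. field; lra.
Qed.

(** These are the Lax inequalities: [h * sl] and [h0 * sl] are the shock speeds relative to the flow
    at heights [h0] and [h]. After squaring, they reduce to the signs of [(h - h0) * (h + 2 * h0)]
    and [(h - h0) * (2 * h + h0)]. *)
Lemma shock_slope_bounds (g h h0 sl : R) :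
  0 < g -> 0 < h0 < h -> 0 < sl -> 2 * h * h0 * sl ^ 2 = g * (h + h0) ->
  sqrt (g * h0) < h * sl /\ h0 * sl < sqrt (g * h).
Proof.
  intros Hg Hh Hsl E. split.
  - rewrite <- (sqrt_pow2 (h * sl)) by nra. apply sqrt_lt_1_alt. split; [nra|].
    apply (Rmult_lt_reg_l (2 * h0)); [lra|].
    replace (2 * h0 * (h * sl) ^ 2) with (h * (2 * h * h0 * sl ^ 2)) by ring.
    rewrite E. assert (0 < (h - h0) * (h + 2 * h0)) by (apply Rmult_lt_0_compat; lra). nra.
  - rewrite <- (sqrt_pow2 (h0 * sl)) by nra. apply sqrt_lt_1_alt. split; [nra|].
    apply (Rmult_lt_reg_l (2 * h)); [lra|].
    replace (2 * h * (h0 * sl) ^ 2) with (h0 * (2 * h * h0 * sl ^ 2)) by ring.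
    rewrite E. assert (0 < (h - h0) * (2 * h + h0)) by (apply Rmult_lt_0_compat; lra). nra.
Qed.

(** The slope is signed, so that [- sl] serves 1-shocks and [sl] serves 2-shocks. *)
Lemma shock_speed_eq (U0 U : state) (sl : R) :
  height U <> height U0 ->
  velocity U = velocity U0 + (height U - height U0) * sl ->
  shock_speed U0 U = velocity U0 + height U * sl /\
  shock_speed U0 U = velocity U + height U0 * sl.
Proof.
  intros Hne Hv. unfold shock_speed, discharge. rewrite Hv. split; field; lra.
Qed.

Lemma shock_speed_sym (U V : state) : shock_speed U V = shock_speed V U.
Proof.
  unfold shock_speed.
  replace (discharge V - discharge U) with (- (discharge U - discharge V)) by ring.
  replace (height V - height U) with (- (height U - height V)) by ring.
  unfold Rdiv. rewrite Rinv_opp. ring.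
Qed.

(** Mass balance is the definition of the speed; momentum balance is the quadratic relation on [sl]
    multiplied by the height jump. *)
Lemma rankine_hugoniot (g : R) (U0 U : state) (sl : R) :
  height U <> height U0 ->
  2 * height U * height U0 * sl ^ 2 = g * (height U + height U0) ->
  velocity U = velocity U0 + (height U - height U0) * sl ->
  shock_speed U0 U * (height U - height U0) = discharge U - discharge U0 /\
  shock_speed U0 U * (discharge U - discharge U0) = momentum_flux g U - momentum_flux g U0.
Proof.
  intros Hne Hsl Hv. split.
  - unfold shock_speed. field. lra.
  - rewrite (proj1 (shock_speed_eq U0 U sl Hne Hv)).
    unfold momentum_flux, discharge. rewrite Hv.
    assert (E : (height U - height U0) * (2 * height U * height U0 * sl ^ 2)
                = (height U - height U0) * (g * (height U + height U0))) by now rewrite Hsl.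
    lra.
Qed.

Lemma lax_shock_1 (g : R) (Um Up : state) (sl : R) :
  0 < g -> 0 < height Um < height Up -> bottom Up = bottom Um -> 0 < sl ->
  2 * height Up * height Um * sl ^ 2 = g * (height Up + height Um) ->
  velocity Up = velocity Um - (height Up - height Um) * sl ->
  lax_shock g F1 Um Up.
Proof.
  intros Hg Hh Hb Hsl Esl Hv.
  assert (Hv' : velocity Up = velocity Um + (height Up - height Um) * (- sl)) by lra.
  destruct (rankine_hugoniot g Um Up (- sl)) as [R1 R2]; [lra | lra | exact Hv' |].
  destruct (shock_speed_eq Um Up (- sl)) as [S1 S2]; [lra | exact Hv' |].
  destruct (shock_slope_bounds g (height Up) (height Um) sl) as [B1 B2]; auto.
  unfold lax_shock. cbv zeta. cbn [lambda].
  repeat split; try assumption; try discriminate; lra.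
Qed.

Lemma lax_shock_2 (g : R) (Um Up : state) (sl : R) :
  0 < g -> 0 < height Up < height Um -> bottom Um = bottom Up -> 0 < sl ->
  2 * height Um * height Up * sl ^ 2 = g * (height Um + height Up) ->
  velocity Um = velocity Up + (height Um - height Up) * sl ->
  lax_shock g F2 Um Up.
Proof.
  intros Hg Hh Hb Hsl Esl Hv.
  destruct (rankine_hugoniot g Up Um sl) as [R1 R2]; [lra | lra | exact Hv |].
  destruct (shock_speed_eq Up Um sl) as [S1 S2]; [lra | exact Hv |].
  destruct (shock_slope_bounds g (height Um) (height Up) sl) as [B1 B2]; auto.
  unfold lax_shock. cbv zeta. rewrite (shock_speed_sym Um Up). cbn [lambda].
  repeat split; try congruence; try discriminate; lra.
Qed.

(** * From wave curves to admissible waves *)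

(** A 1-shock travels at [height U0 * sl] below [velocity U], and a 1-rarefaction ends at one
    celerity below it. The bound serves to order this wave before the 2-wave. *)
Lemma W1_wave (g : R) (U0 U : state) :
  0 < g -> 0 < height U0 -> W1 g U0 U ->
  exists w, is_wave g F1 U0 U w /\ fast g w < velocity U.
Proof.
  intros Hg H0 (H & Hb & [[Hgt Hv]|[Hle Hv]]).
  - destruct (shock_slope g (height U) (height U0) Hg H H0) as [Hsl Esl].
    set (sl := sqrt (g / 2) * sqrt (1 / height U + 1 / height U0)) in *.
    assert (Hv' : velocity U = velocity U0 - (height U - height U0) * sl)
      by (rewrite Hv; unfold sl; ring).
    exists (Shock F1 U0 U). split.
    + unfold is_wave. split; [reflexivity|]. split; [reflexivity|]. split; [reflexivity|].
      now apply (lax_shock_1 g U0 U sl).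
    + simpl. destruct (shock_speed_eq U0 U (- sl)) as [_ S]; [lra | lra |].
      rewrite S. nra.
  - destruct (rarefaction_1 g U0 U) as [f Hf]; auto.
    exists (Rarefaction F1 U0 U f). split.
    + unfold is_wave. split; [reflexivity|]. split; [reflexivity|]. split; [reflexivity|].
      exact Hf.
    + simpl. assert (0 < sqrt (g * height U)) by (apply sqrt_lt_R0; nra). lra.
Qed.

(** Mirror image of the 1-wave. The final disjunction records the fast edge, to be compared later
    with the zero speed of the stationary wave. *)
Lemma W2B_wave (g : R) (U0 U : state) :
  0 < g -> 0 < height U0 -> W2B g U0 U ->
  exists w, is_wave g F2 U U0 w /\ velocity U < slow g w /\
    ((height U <= height U0 /\ fast g w = lambda g F2 U0) \/
     (S2B g U0 U /\ fast g w = shock_speed U0 U)).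
Proof.
  intros Hg H0 [HS|(H & Hb & Hle & Hv)].
  - destruct (HS) as (H & Hb & Hgt & Hv).
    destruct (shock_slope g (height U) (height U0) Hg H H0) as [Hsl Esl].
    set (sl := sqrt (g / 2) * sqrt (1 / height U + 1 / height U0)) in *.
    assert (Hv' : velocity U = velocity U0 + (height U - height U0) * sl)
      by (rewrite Hv; unfold sl; ring).
    exists (Shock F2 U U0). split; [|split].
    + unfold is_wave. split; [reflexivity|]. split; [reflexivity|]. split; [reflexivity|].
      now apply (lax_shock_2 g U U0 sl).
    + simpl. rewrite shock_speed_sym.
      destruct (shock_speed_eq U0 U sl) as [_ S]; [lra | lra |]. rewrite S. nra.
    + right. split; [exact HS | apply shock_speed_sym].
  - destruct (rarefaction_2 g U U0) as [f Hf]; auto.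
    exists (Rarefaction F2 U U0 f). split.
    { unfold is_wave. split; [reflexivity|]. split; [reflexivity|]. split; [reflexivity|].
      exact Hf. }
    simpl. assert (0 < sqrt (g * height U)) by (apply sqrt_lt_R0; nra).
    split; [lra|]. left. split; [exact Hle | reflexivity].
Qed.

(** * Speed of 2-shocks and the zero-speed state *)

(** Squaring [height U * sl] removes the slope: [U] then enters only through its height, and zero
    speed becomes a quadratic equation. *)
Lemma S2B_shock_speed (g : R) (U0 U : state) :
  0 < g -> 0 < height U0 -> S2B g U0 U ->
  shock_speed U0 U = velocity U0
    + sqrt (g * height U * (height U + height U0) / (2 * height U0)).
Proof.
  intros Hg H0 (H & _ & Hgt & Hv).
  destruct (shock_slope g (height U) (height U0) Hg H H0) as [Hsl Esl].
  set (sl := sqrt (g / 2) * sqrt (1 / height U + 1 / height U0)) in *.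
  destruct (shock_speed_eq U0 U sl) as [S _]; [lra | rewrite Hv; unfold sl; ring |].
  rewrite S. f_equal. rewrite <- (sqrt_pow2 (height U * sl)) by nra. f_equal.
  apply (Rmult_eq_reg_l (2 * height U0)); [|lra].
  replace (2 * height U0 * (height U * sl) ^ 2)
    with (height U * (2 * height U * height U0 * sl ^ 2)) by ring.
  rewrite Esl. field; lra.
Qed.

(** The direct implication bounds the speed of the 2-shock by 0 in the theorem; the converse gives
    uniqueness of the zero-speed state. *)
Lemma S2B_shock_speed_mono (g : R) (U0 U V : state) :
  0 < g -> 0 < height U0 -> S2B g U0 U -> S2B g U0 V ->
  (height U <= height V <-> shock_speed U0 U <= shock_speed U0 V).
Proof.
  intros Hg H0 HU HV.
  assert (Hmono : forall h k, 0 < h -> h < k ->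
    sqrt (g * h * (h + height U0) / (2 * height U0))
    < sqrt (g * k * (k + height U0) / (2 * height U0))).
  { intros h k Hh Hhk. apply sqrt_lt_1_alt. unfold Rdiv.
    assert (0 < / (2 * height U0)) by (apply Rinv_0_lt_compat; lra).
    assert (0 < g * h) by nra. assert (g * h < g * k) by nra.
    split.
    - apply Rmult_le_pos; [apply Rmult_le_pos; lra | lra].
    - apply Rmult_lt_compat_r; [assumption|].
      apply Rmult_gt_0_lt_compat; lra. }
  rewrite (S2B_shock_speed g U0 U), (S2B_shock_speed g U0 V) by assumption.
  pose proof (proj1 HU). pose proof (proj1 HV).
  split; intros Hle.
  - destruct Hle as [Hlt|E]; [|rewrite E; apply Rle_refl].
    apply Rplus_le_compat_l, Rlt_le, Hmono; assumption.
  - destruct (Rle_lt_dec (height U) (height V)) as [|Hlt]; [assumption|].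
    apply (Hmono (height V)) in Hlt; [lra | assumption].
Qed.

Lemma A3_spec (g : R) (U : state) :
  0 < g -> (A3 g U <-> 0 < height U /\ velocity U < 0 /\ g * height U < velocity U ^ 2).
Proof.
  intros Hg. unfold A3; cbn [lambda]. split.
  - intros [H1 H2].
    assert (Hs : 0 < sqrt (g * height U)) by lra.
    assert (Hh : 0 < g * height U).
    (* [sqrt] is 0 on nonpositive reals, so distinct characteristic speeds force a positive
       height. *)
    { apply Rnot_le_lt. intros Hle. rewrite (sqrt_neg_0 _ Hle) in Hs. lra. }
    assert (E : sqrt (g * height U) ^ 2 = g * height U) by (apply pow2_sqrt; lra).
    repeat split; [nra | lra | nra].
  - intros (Hh & Hv & Hlt).
    assert (0 < sqrt (g * height U)) by (apply sqrt_lt_R0; nra).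
    assert (E : sqrt (g * height U) ^ 2 = g * height U) by (apply pow2_sqrt; nra).
    split; [|lra]. nra.
Qed.

(* Zero shock speed amounts to [g h (h + h0) = 2 h0 u0^2]; take its positive root. *)
Lemma bar_exists_unique (g : R) (U0 : state) :
  0 < g -> A3 g U0 -> exists Ubar, unique (is_bar g U0) Ubar.
Proof.
  intros Hg HA. destruct (proj1 (A3_spec g U0 Hg) HA) as (H0 & Hv0 & Hsup).
  set (h0 := height U0) in *. set (u0 := velocity U0) in *.
  assert (Hd : 0 < h0 ^ 2 + 8 * h0 * u0 ^ 2 / g).
  { assert (0 < 8 * h0 * u0 ^ 2 / g) by (apply Rdiv_lt_0_compat; nra). nra. }
  set (h := (- h0 + sqrt (h0 ^ 2 + 8 * h0 * u0 ^ 2 / g)) / 2).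
  assert (Eh : g * (h * (h + h0)) = 2 * h0 * u0 ^ 2).
  { unfold h. set (d := sqrt _).
    assert (E : d ^ 2 = h0 ^ 2 + 8 * h0 * u0 ^ 2 / g) by (apply pow2_sqrt; lra).
    replace ((- h0 + d) / 2 * ((- h0 + d) / 2 + h0)) with ((d ^ 2 - h0 ^ 2) / 4) by field.
    rewrite E. field; lra. }
  assert (Hh : h0 < h).
  (* [h0 < h] means that the root exceeds [3 * h0], which holds because [u0 ^ 2 > g * h0] puts the
     discriminant above [9 * h0 ^ 2]. *)
  { assert (h0 * 3 < sqrt (h0 ^ 2 + 8 * h0 * u0 ^ 2 / g)); [|unfold h; lra].
    rewrite <- (sqrt_pow2 (h0 * 3)) by lra. apply sqrt_lt_1_alt. split; [nra|].
    apply (Rmult_lt_reg_l g); [exact Hg|].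
    replace (g * (h0 ^ 2 + 8 * h0 * u0 ^ 2 / g)) with (g * h0 ^ 2 + 8 * h0 * u0 ^ 2)
      by (field; lra). nra. }
  set (Ub := mkState h (u0 + sqrt (g / 2) * (h - h0) * sqrt (1 / h + 1 / h0)) (bottom U0)).
  assert (HS : S2B g U0 Ub) by (repeat split; unfold Ub; simpl; auto; lra).
  assert (Hz : shock_speed U0 Ub = 0).
  { rewrite (S2B_shock_speed g U0 Ub Hg H0 HS). simpl height. fold h0 u0.
    replace (g * h * (h + h0) / (2 * h0)) with ((- u0) ^ 2).
    - rewrite sqrt_pow2 by lra. ring.
    - replace (g * h * (h + h0)) with (g * (h * (h + h0))) by ring. rewrite Eh. field; lra. }
  exists Ub. split.
  - split; [exact HA | split; [exact HS | split; [|exact Hz]]].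
    (* Zero speed means equal discharges; the sign of the velocity is inherited from [u0]. *)
    assert (Hq : h * velocity Ub = h0 * u0).
    { unfold shock_speed in Hz.
      assert (E : discharge Ub - discharge U0 = 0).
      { replace (discharge Ub - discharge U0)
          with ((discharge Ub - discharge U0) / (height Ub - height U0)
                * (height Ub - height U0)) by (field; unfold Ub; simpl; fold h0; lra).
        rewrite Hz. ring. }
      unfold discharge in E. change (height Ub) with h in E. fold h0 u0 in E. lra. }
    assert (Hvb : velocity Ub < 0) by nra.
    (* By [Hq] and [Eh], subcriticality becomes [h0 * (h + h0) < 2 * h ^ 2]. *)
    assert (Hsub : velocity Ub ^ 2 < g * h).
    { apply (Rmult_lt_reg_l (2 * h ^ 2)); [nra|].
      replace (2 * h ^ 2 * velocity Ub ^ 2) with (2 * (h * velocity Ub) ^ 2) by ring.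
      rewrite Hq. replace (2 * (h0 * u0) ^ 2) with (h0 * (2 * h0 * u0 ^ 2)) by ring.
      rewrite <- Eh.
      replace (h0 * (g * (h * (h + h0)))) with ((g * h) * (h0 * (h + h0))) by ring.
      replace (2 * h ^ 2 * (g * h)) with ((g * h) * (2 * h ^ 2)) by ring.
      apply Rmult_lt_compat_l; nra. }
    assert (E : sqrt (g * h) ^ 2 = g * h) by (apply pow2_sqrt; nra).
    assert (Hs : 0 < sqrt (g * h)) by (apply sqrt_lt_R0; nra).
    split; [split|]; cbn [lambda]; change (height Ub) with h; [nra | lra | exact Hvb].
  - intros V (_ & HSV & _ & HzV).
    assert (E : h = height V).
    { apply Rle_antisym;
      [apply (S2B_shock_speed_mono g U0 Ub V) | apply (S2B_shock_speed_mono g U0 V Ub)];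
      auto; lra. }
    apply state_eq; [exact E | | symmetry; apply HSV].
    destruct HSV as (_ & _ & _ & ->). rewrite <- E. reflexivity.
Qed.

(** * Bottom level along stationary curves *)

(** Factoring out [y - x] turns monotonicity into a polynomial sign condition, without
    derivatives. *)
Lemma W3_bottom_diff (g : R) (U : state) (x y : R) :
  0 < g -> 0 < x -> 0 < y ->
  W3_bottom g U y - W3_bottom g U x
  = (y - x) * (discharge U ^ 2 * (x + y) - 2 * g * (x * y) ^ 2) / (2 * g * (x * y) ^ 2).
Proof.
  intros Hg Hx Hy. unfold W3_bottom. field. lra.
Qed.

(* [q^2 / g] is the cube of the critical height. *)
Lemma W3_bottom_increasing (g : R) (U : state) (x y : R) :
  0 < g -> 0 < x < y -> g * y ^ 3 <= discharge U ^ 2 ->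
  W3_bottom g U x < W3_bottom g U y.
Proof.
  intros Hg Hxy Hq. apply Rminus_lt_0. rewrite W3_bottom_diff by lra.
  assert (0 < (x * y) ^ 2) by (apply pow_lt; nra).
  apply Rdiv_lt_0_compat; [|nra]. apply Rmult_lt_0_compat; [lra|].
  apply Rlt_0_minus.
  (* With [g * y ^ 3] in place of the squared discharge, the difference is
     [g * y ^ 2 * ((y - x) * (y + 2 * x))]. *)
  apply Rlt_le_trans with (g * y ^ 3 * (x + y)); [|apply Rmult_le_compat_r; lra].
  assert (0 < (y - x) * (y + 2 * x)) by (apply Rmult_lt_0_compat; lra).
  assert (0 < g * y ^ 2) by nra.
  assert (0 < g * y ^ 2 * ((y - x) * (y + 2 * x))) by (apply Rmult_lt_0_compat; lra). nra.
Qed.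

Lemma W3_iff (g : R) (U0 U : state) :
  0 < g -> 0 < height U0 -> 0 < height U ->
  (W3 g U0 U <-> velocity U = discharge U0 / height U /\
                 bottom U = W3_bottom g U0 (height U)).
Proof.
  intros Hg H0 H. unfold W3, W3_bottom. split.
  - intros (_ & _ & Hq & Hb).
    assert (E : velocity U = discharge U0 / height U)
      by (rewrite <- Hq; unfold discharge; field; lra).
    split; [exact E|]. rewrite <- E.
    apply (Rmult_eq_reg_l g); [|lra].
    replace (g * (bottom U0 + (velocity U0 ^ 2 - velocity U ^ 2) / (2 * g)
                  + height U0 - height U))
      with (velocity U0 ^ 2 / 2 + g * (height U0 + bottom U0)
            - velocity U ^ 2 / 2 - g * height U) by (field; lra).
    lra.
  - intros [Hv Hb]. repeat split; auto.
    + unfold discharge at 1. rewrite Hv. field; lra.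
    + rewrite Hb, <- Hv. field; lra.
Qed.

Lemma W3_bottom_base (g : R) (U : state) :
  0 < g -> 0 < height U -> W3_bottom g U (height U) = bottom U.
Proof.
  intros Hg H. unfold W3_bottom, discharge. field. lra.
Qed.

Lemma W3_sym (g : R) (U V : state) : W3 g U V -> W3 g V U.
Proof. intros (? & ? & ? & ?). repeat split; auto. Qed.

(** The bottom function depends on its base point only through discharge and energy, which
    stationary waves preserve. *)
Lemma W3_bottom_curve (g : R) (U V : state) (h : R) :
  0 < g -> W3 g U V -> W3_bottom g V h = W3_bottom g U h.
Proof.
  intros Hg (_ & _ & Hq & Hb). unfold W3_bottom. rewrite Hq.
  apply (Rmult_eq_reg_l g); [|lra].
  unfold Rdiv. rewrite Rinv_mult.
  set (r := discharge U * / h).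
  replace (g * (bottom V + (velocity V ^ 2 - r ^ 2) * (/ 2 * / g) + height V - h))
    with (velocity V ^ 2 / 2 + g * (height V + bottom V) - r ^ 2 / 2 - g * h) by (field; lra).
  rewrite Hb. field; lra.
Qed.

(** [U1] is reached from [UR], whereas the stationary wave runs from [U1] to [UR]. *)
Lemma MC_sym (g : R) (U V : state) : 0 < g -> W3 g U V -> MC g U V -> MC g V U.
Proof.
  intros Hg HW HMC. unfold MC. rewrite (Rmin_comm (height V)), (Rmax_comm (height V)).
  destruct HMC as [HM|HM]; [left|right]; intros x y Hx Hxy Hy;
    rewrite !(W3_bottom_curve g U V) by assumption; now apply HM.
Qed.

Lemma supercritical_discharge (g : R) (U : state) :
  0 < height U -> g * height U < velocity U ^ 2 -> g * height U ^ 3 < discharge U ^ 2.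
Proof.
  intros H Hs. unfold discharge.
  replace (g * height U ^ 3) with (height U ^ 2 * (g * height U)) by ring.
  rewrite Rpow_mult_distr. apply Rmult_lt_compat_l; [nra | exact Hs].
Qed.

(** * The stationary state at a lower bottom level *)

Lemma SW_exists_unique (g a : R) (U0 : state) :
  0 < g -> A3 g U0 -> a < bottom U0 ->
  exists U, A3 g U /\ unique (SW g U0 a) U.
Proof.
  intros Hg HA Ha. destruct (proj1 (A3_spec g U0 Hg) HA) as (H0 & Hv0 & Hsup).
  pose proof (supercritical_discharge g U0 H0 Hsup) as Hq.
  assert (Hinc : forall x y, 0 < x < y -> y <= height U0 ->
                 W3_bottom g U0 x < W3_bottom g U0 y).
  { intros x y Hxy Hy. apply W3_bottom_increasing; auto.
    assert (y ^ 3 <= height U0 ^ 3) by (apply pow_incr; lra). nra. }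
  assert (Hqneg : discharge U0 < 0) by (unfold discharge; nra).
  (* Clearing the denominator [h ^ 2] makes the function continuous down to 0. *)
  set (p := fun h => (velocity U0 ^ 2 + 2 * g * (bottom U0 - a + height U0 - h)) * h ^ 2
                     - discharge U0 ^ 2).
  assert (Hp : forall h, 0 < h -> p h = 2 * g * h ^ 2 * (W3_bottom g U0 h - a)).
  { intros h Hh. unfold p, W3_bottom, discharge. field. lra. }
  (* [p 0] is minus the squared discharge, hence negative; [p (height U0)] has the sign of
     [bottom U0 - a], hence is positive. *)
  destruct (IVT p 0 (height U0)) as (h & Hh & Hph).
  - unfold p. reg.
  - exact H0.
  - unfold p. nra.
  - rewrite Hp by exact H0. rewrite W3_bottom_base by assumption.
    assert (0 < height U0 ^ 2) by (apply pow_lt; lra).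
    apply Rmult_lt_0_compat; [nra | lra].
  - assert (Hhpos : 0 < h).
    { destruct (Hh) as [[Hlt|<-] _]; [exact Hlt|]. unfold p in Hph. nra. }
    assert (Ebot : W3_bottom g U0 h = a).
    { rewrite Hp in Hph by exact Hhpos.
      assert (0 < h ^ 2) by (apply pow_lt; lra).
      destruct (Rmult_integral _ _ Hph); [nra | lra]. }
    assert (Hlt : h < height U0).
    { destruct (proj2 Hh) as [Hlt|E]; [exact Hlt|].
      rewrite E, W3_bottom_base in Ebot by assumption. lra. }
    exists (mkState h (discharge U0 / h) a). split.
    + apply A3_spec; [exact Hg|]. simpl height; simpl velocity.
      repeat split; [exact Hhpos | |].
      * assert (0 < - discharge U0 / h) by (apply Rdiv_lt_0_compat; lra).
        unfold Rdiv in *. lra.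
      * replace ((discharge U0 / h) ^ 2) with (discharge U0 ^ 2 / h ^ 2) by (field; lra).
        apply (Rmult_lt_reg_r (h ^ 2)); [apply pow_lt; lra|].
        replace (discharge U0 ^ 2 / h ^ 2 * h ^ 2) with (discharge U0 ^ 2) by (field; lra).
        assert (h ^ 3 <= height U0 ^ 3) by (apply pow_incr; lra). nra.
    + split; [split; [|split; [|reflexivity]]|].
      * apply W3_iff; simpl; auto.
      * left. simpl. rewrite Rmin_right, Rmax_left by lra. intros x y Hx [Hxy|E] Hy; [|rewrite E; apply Rle_refl].
        apply Rlt_le, Hinc; lra.
      * intros V (HW & HMC & Hb).
        assert (HV : 0 < height V) by apply HW.
        destruct (proj1 (W3_iff g U0 V Hg H0 HV) HW) as [Ev Eb]. rewrite Hb in Eb.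
        assert (E : h = height V).
        { destruct (Rtotal_order (height V) (height U0)) as [HVlt|[HVe|HVgt]].
          - destruct (Rtotal_order h (height V)) as [L|[E|L]]; [|exact E|].
            + specialize (Hinc h (height V)). lra.
            + specialize (Hinc (height V) h). lra.
          - rewrite HVe, W3_bottom_base in Eb by assumption. lra.
          - exfalso. unfold MC in HMC. rewrite Rmin_left, Rmax_right in HMC by lra.
            (* Beyond [height U0] the bottom still rises before the critical
               height, while its end value [a] lies below [bottom U0]. *)
            assert (Hy : exists y, height U0 < y <= height V /\
                           W3_bottom g U0 (height U0) < W3_bottom g U0 y).
            (* [m] is the geometric mean of [height U0] and [velocity U0 ^ 2 / g]. For
               [height U0 < y <= m], [2 * g * y ^ 2 <= 2 * height U0 * velocity U0 ^ 2], so the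
               bracket in the bottom difference is at least [velocity U0 ^ 2 * (y - height U0)]. *)
            { set (m := sqrt (height U0 * (velocity U0 ^ 2 / g))).
              assert (Hu : height U0 < velocity U0 ^ 2 / g).
              { apply (Rmult_lt_reg_l g); [exact Hg|].
                replace (g * (velocity U0 ^ 2 / g)) with (velocity U0 ^ 2) by (field; lra).
                exact Hsup. }
              assert (Em : m ^ 2 = height U0 * (velocity U0 ^ 2 / g))
                by (apply pow2_sqrt; nra).
              assert (Hm : height U0 < m).
              { unfold m. rewrite <- (sqrt_pow2 (height U0)) at 1 by lra.
                apply sqrt_lt_1_alt. split; nra. }
              (* The minimum keeps the witness on the arc ending at [V]. *)
              exists (Rmin (height V) m).
              pose proof (Rmin_l (height V) m). pose proof (Rmin_r (height V) m).
              assert (Hgt : height U0 < Rmin (height V) m) by (now apply Rmin_glb_lt).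
              set (y := Rmin (height V) m) in *. split; [lra|].
              apply Rminus_lt_0. rewrite W3_bottom_diff by lra.
              assert (0 < (height U0 * y) ^ 2) by (apply pow_lt; nra).
              apply Rdiv_lt_0_compat; [|nra]. apply Rmult_lt_0_compat; [lra|].
              assert (Hy2 : g * y ^ 2 <= height U0 * velocity U0 ^ 2).
              { replace (height U0 * velocity U0 ^ 2) with (g * m ^ 2)
                  by (rewrite Em; field; lra).
                apply Rmult_le_compat_l; [lra|]. apply pow_incr; lra. }
              unfold discharge.
              replace ((height U0 * velocity U0) ^ 2 * (height U0 + y)
                       - 2 * g * (height U0 * y) ^ 2)
                with (height U0 ^ 2 * (velocity U0 ^ 2 * (height U0 + y) - 2 * (g * y ^ 2)))
                by ring.
              apply Rmult_lt_0_compat; [nra|].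
              assert (0 < velocity U0 ^ 2 * (y - height U0))
                by (apply Rmult_lt_0_compat; nra).
              nra. }
            destruct Hy as (y & Hy & Hup). rewrite W3_bottom_base in Hup by assumption.
            (* A nondecreasing bottom contradicts the lower end value [a]; a nonincreasing one
               contradicts the rise at [y]. *)
            destruct HMC as [HM|HM].
            + specialize (HM (height U0) (height V)).
              rewrite W3_bottom_base in HM by assumption. lra.
            + specialize (HM (height U0) y).
              rewrite W3_bottom_base in HM by assumption. lra. }
        apply state_eq; simpl; auto. rewrite Ev, E. reflexivity.
Qed.

(** * Assembly of the three waves *)

Theorem theorem4p4 (g : R) (UL UR : state)
  (hg : 0 < g) (hL : 0 < height UL)
  (ha : bottom UL < bottom UR) (hR : A3 g UR) :
  exists U1 U1bar : state,
    unique (SW g UR (bottom UL)) U1 /\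
    unique (is_bar g U1) U1bar /\
    forall U2 : state,
      W2B g U1 U2 -> W1 g UL U2 ->
      height U2 <= height U1bar ->
      exists (w1 w2 w3 : wave) (U : R -> R -> state),
        is_wave g F1 UL U2 w1 /\
        is_wave g F2 U2 U1 w2 /\
        is_wave g F3 U1 UR w3 /\
        riemann_solution g UL UR [w1; w2; w3] U.
Proof.
  destruct (SW_exists_unique g (bottom UL) UR hg hR ha) as (U1 & HA1 & HSW).
  destruct (bar_exists_unique g U1 hg HA1) as (Ub & Hbar).
  exists U1, Ub. split; [exact HSW | split; [exact Hbar|]].
  intros U2 HW2 HW1 Hh2.
  destruct HSW as [(HW & HMC & Hb1) _].
  assert (H1 : 0 < height U1) by apply HW.
  destruct (W1_wave g UL U2 hg hL HW1) as (w1 & Hw1 & Hfast1).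
  destruct (W2B_wave g U1 U2 hg H1 HW2) as (w2 & Hw2 & Hslow2 & Hfast2).
  assert (Hw3 : is_wave g F3 U1 UR (Stationary U1 UR)).
  { repeat split; try (now apply MC_sym); apply (W3_sym _ _ _ HW). }
  assert (Hneg : fast g w2 <= 0).
  { destruct Hfast2 as [[_ ->]|[HS ->]].
    - apply Rlt_le, HA1.
    - destruct Hbar as [(_ & HSb & _ & Hz) _]. rewrite <- Hz.
      now apply (S2B_shock_speed_mono g U1 U2 Ub). }
  assert (Hb2 : bottom U2 = bottom UL) by apply HW1.
  exists w1, w2, (Stationary U1 UR),
    (fun x t => profile g UL [w1; w2; Stationary U1 UR] (x / t)).
  repeat (split; [assumption|]).
  destruct Hw1 as (_ & L1 & R1 & Ad1), Hw2 as (_ & L2 & R2 & Ad2), Hw3 as (_ & _ & _ & Ad3).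
  apply riemann_solution_of_chain.
  - cbn [chain]. rewrite R1, R2. cbn [wave_left wave_right slow].
    repeat (split; [solve [assumption | reflexivity | lra]|]). reflexivity.
  (* Only the stationary wave changes the bottom, so the variation equals the bound. *)
  - unfold bottom_variation. cbn [map fold_right wave_left wave_right].
    rewrite R1, R2, L1, L2, Hb2, Hb1, (Rabs_minus_sym (bottom UR)).
    rewrite !Rminus_diag, Rabs_R0. lra.
Qed.
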